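(* There are exactly $10$ equivalence classes (under the action of $S_6$ permuting the variables) of square free Cremona sets $F$ of monomials of degree $3$ in $\mathbb{K}[x_1,\ldots,x_6]$ whose log matrix $A_F$ is of type 1, i.e. $A_F$ has no row with five entries equal to $1$ but has a row with exactly one entry equal to $1$.
   Context: $\mathbb{K}$ is a field. A monomial $f\in\mathbb{K}[x_1,\ldots,x_n]$ is square free if $x_i^2\nmid f$ for all $i$. For a set $F=\{f_1,\ldots,f_n\}$ of $n$ (distinct) monomials of the same degree $d$ in $\mathbb{K}[x_1,\ldots,x_n]$, the log matrix $A_F=(v_{ij})_{n\times n}$ is the matrix whose $j$-th column is the exponent vector of $f_j$, i.e. $f_j=x_1^{v_{1j}}\cdots x_n^{v_{nj}}$ (well defined up to permuting columns). $F$ is a square free set if all its monomials are square free. $F$ is a Cremona set if the rational map $\mathbb{P}^{n-1}\dashrightarrow\mathbb{P}^{n-1}$, $\underline{x}\mapsto(f_1(\underline{x}):\cdots:f_n(\underline{x}))$, is birational; algebraically, if $\mathbb{K}[f_1,\ldots,f_n]\subset \mathbb{K}[\underline{x}_d]$ becomes an equality at the level of fields of fractions, where $\mathbb{K}[\underline{x}_d]$ is the Veronese algebra generated by all monomials of degree $d$. The order of the elements of $F$ is irrelevant. $S_n$ acts on monomials by $\sigma*(x_1^{a_1}\cdots x_n^{a_n})=x_{\sigma(1)}^{a_1}\cdots x_{\sigma(n)}^{a_n}$ and on sets of monomials elementwise; two Cremona sets are equivalent if they lie in the same $S_n$-orbit. Here $n=6$, $d=3$. *)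

(* Defs.v *)
(* MathComp, with multinomials ('X_{1..n}, {mpoly K[n]}) and finmap. *)
From mathcomp Require Export all_boot all_order all_fingroup all_algebra.
From mathcomp Require Export finmap.
From mathcomp Require Export mpoly.

Set Implicit Arguments.
Unset Strict Implicit.
Unset Printing Implicit Defensive.

Import GRing.Theory.
Local Open Scope ring_scope.
Local Open Scope fset_scope.

(* A monomial x_1^a_1 ... x_n^a_n is identified with its exponent vector
   a : 'X_{1..n}; the polynomial it denotes in {mpoly K[n]} is 'X_[K, a]. *)

Definition monomial_set (n d : nat) (F : {fset 'X_{1..n}}) : Prop :=
  #|` F| = n /\ (forall m, m \in F -> mdeg m = d).

Definition square_free (n : nat) (m : 'X_{1..n}) : Prop :=
  forall i : 'I_n, ~~ (U_(i) *+ 2 <= m)%MM.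

Definition square_free_set (n : nat) (F : {fset 'X_{1..n}}) : Prop :=
  forall m, m \in F -> square_free m.

(* The columns follow finmap's canonical enumeration of F; any other
   enumeration permutes the columns. The default 0%MM is never reached when
   #|` F| = n. *)
Definition log_matrix (n : nat) (F : {fset 'X_{1..n}}) : 'M[nat]_n :=
  \matrix_(i < n, j < n) (nth 0%MM (enum_fset F) j) i.

Definition row_ones (n : nat) (A : 'M[nat]_n) (i : 'I_n) : nat :=
  #|[set j | A i j == 1%N]|.

Definition type1 (A : 'M[nat]_6) : Prop :=
  ~ (exists i, row_ones A i = 5%N) /\ (exists i, row_ones A i = 1%N).

(* The K-subalgebra of K[x_1, ..., x_n] generated by the monomials in S. *)
Inductive monomial_algebra (K : fieldType) (n : nat) (S : 'X_{1..n} -> Prop) :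
    {mpoly K[n]} -> Prop :=
| monomial_algebra_const c : monomial_algebra S c%:MP
| monomial_algebra_gen m : S m -> monomial_algebra S 'X_[K, m]
| monomial_algebra_add p q :
    monomial_algebra S p -> monomial_algebra S q -> monomial_algebra S (p + q)
| monomial_algebra_mul p q :
    monomial_algebra S p -> monomial_algebra S q -> monomial_algebra S (p * q).

(* The field of fractions of a subring A of K[x_1, ..., x_n], realized inside
   K(x_1, ..., x_n). *)
Definition field_of_fractions (K : fieldType) (n : nat)
    (A : {mpoly K[n]} -> Prop) (z : {fraction {mpoly K[n]}}) : Prop :=
  exists p q, [/\ A p, A q, q != 0 & z = tofrac p / tofrac q].

(* Birationality of x |-> (f_1(x) : ... : f_n(x)) in its algebraic form: the
   inclusion of K[f_1, ..., f_n] in the d-th Veronese algebra induces an equality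
   of fields of fractions. *)
Definition cremona (K : fieldType) (n d : nat) (F : {fset 'X_{1..n}}) : Prop :=
  monomial_set d F /\
  forall z : {fraction {mpoly K[n]}},
    field_of_fractions (monomial_algebra (fun m => m \in F)) z <->
    field_of_fractions (monomial_algebra (fun m => mdeg m = d)) z.

(* s * (x_1^a_1 ... x_n^a_n) = x_(s 1)^a_1 ... x_(s n)^a_n: the exponent of x_j
   in the image is a_(s^-1 j). *)
Definition act_monomial (n : nat) (s : 'S_n) (m : 'X_{1..n}) : 'X_{1..n} :=
  [multinom m ((s^-1)%g j) | j < n].

Definition act_set (n : nat) (s : 'S_n) (F : {fset 'X_{1..n}}) :
    {fset 'X_{1..n}} :=
  [fset act_monomial s m | m in F].

Definition equivalent (n : nat) (F G : {fset 'X_{1..n}}) : Prop :=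
  exists s : 'S_n, G = act_set s F.

(* C is an equivalence class of [equivalent] restricted to the sets in X. *)
Definition equivalence_class (n : nat) (X : {fset 'X_{1..n}} -> Prop)
    (C : {fset {fset 'X_{1..n}}}) : Prop :=
  exists2 F, X F & forall G, G \in C <-> X G /\ equivalent F G.

Definition type1_square_free_cremona (K : fieldType) (F : {fset 'X_{1..6}}) :
    Prop :=
  [/\ cremona K 3 F, square_free_set F & type1 (log_matrix F)].

(* Main.v *)
From mathcomp Require Import zify.
Require Import Defs.

(* Comparing supports in an identity q * x^m = p between elements of K[F] shows
   that F is a Cremona set iff every monomial of degree d lies in the lattice
   spanned by F; this criterion is independent of K and invariant under S_n.
   Number the variables x_0, ..., x_5. For type 1 we may assume that x_0 occurs
   only in x_0 x_1 x_2. The other five monomials are then products of three of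
   the variables x_1, ..., x_5, i.e. the complements of the edges of a graph with
   five edges on {1, ..., 5}. If no row of the log matrix has five ones, either
   this graph has a bipartite component, and then a nonconstant weight of the
   variables is constant on F, contradicting the criterion; or it is connected
   with a single cycle, of odd length, and 1 and 2 are not leaves. Up to
   isomorphism there are ten such graphs with a distinguished pair {1, 2}. *)

Set Implicit Arguments.
Unset Strict Implicit.
Unset Printing Implicit Defensive.

Import GRing.Theory.
Local Open Scope fset_scope.

(** * The lattice criterion *)

Section Lattice.

Variable n : nat.
Implicit Types (S : 'X_{1..n} -> Prop) (a b c m : 'X_{1..n}).

Inductive monomial_monoid S : 'X_{1..n} -> Prop :=
| monomial_monoid0 : monomial_monoid S 0%MM
| monomial_monoidS a b :
    S a -> monomial_monoid S b -> monomial_monoid S (a + b)%MM.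

(* [a - b] lies in the subgroup of [Z^n] generated by [S]. *)
Definition lattice_eq S a b : Prop :=
  exists s t, [/\ monomial_monoid S s, monomial_monoid S t & (a + s = b + t)%MM].

Lemma monomial_monoid_gen S a : S a -> monomial_monoid S a.
Proof. by move=> Sa; rewrite -[a]addm0; constructor=> //; constructor. Qed.

Lemma monomial_monoidD S a b :
  monomial_monoid S a -> monomial_monoid S b -> monomial_monoid S (a + b)%MM.
Proof.
move=> Sa Sb; elim: Sa => [|x y Sx _ IH]; first by rewrite add0m.
by rewrite -addmA; constructor.
Qed.

Lemma lattice_eq_refl S a : lattice_eq S a a.
Proof. by exists 0%MM, 0%MM; split=> //; constructor. Qed.

Lemma lattice_eq_sym S a b : lattice_eq S a b -> lattice_eq S b a.
Proof. by case=> s [t [Ss St e]]; exists t, s; split. Qed.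

Lemma lattice_eqD S a b c d :
  lattice_eq S a b -> lattice_eq S c d -> lattice_eq S (a + c)%MM (b + d)%MM.
Proof.
move=> [s [t [Ss St e]]] [s' [t' [Ss' St' e']]].
exists (s + s')%MM, (t + t')%MM; split; try exact: monomial_monoidD.
apply/mnmP=> i; move/mnmP/(_ i): e; move/mnmP/(_ i): e'.
by rewrite !mnmDE; lia.
Qed.

Lemma lattice_eq_cancel S a b c d :
  lattice_eq S (a + c)%MM (b + d)%MM -> lattice_eq S c d -> lattice_eq S a b.
Proof.
move=> [s [t [Ss St e]]] [s' [t' [Ss' St' e']]].
exists (s + t')%MM, (t + s')%MM; split; try exact: monomial_monoidD.
apply/mnmP=> i; move/mnmP/(_ i): e; move/mnmP/(_ i): e'.
by rewrite !mnmDE; lia.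
Qed.

Lemma lattice_eq_trans S b a c :
  lattice_eq S a b -> lattice_eq S b c -> lattice_eq S a c.
Proof.
move=> ab bc; apply: (@lattice_eq_cancel _ _ _ b b); last exact: lattice_eq_refl.
by rewrite [(c + b)%MM]addmC; apply: lattice_eqD.
Qed.

Lemma lattice_eq_gen S a b : S a -> S b -> lattice_eq S a b.
Proof.
by move=> Sa Sb; exists b, a; split; rewrite 1?addmC //; apply: monomial_monoid_gen.
Qed.

Lemma lattice_eq0_gen S a : S a -> lattice_eq S a 0%MM.
Proof.
move=> Sa; exists 0%MM, a; split; rewrite 1?addmC //; first by constructor.
exact: monomial_monoid_gen.
Qed.

End Lattice.

(** * Birationality in terms of the lattice spanned by the exponents *)

Section Cremona.

Variables (K : fieldType) (n d : nat).
Implicit Types (S : 'X_{1..n} -> Prop) (p q : {mpoly K[n]}).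
Local Open Scope ring_scope.

(** Cancellation can only shrink supports, and the support of a product lies in the sumset of the
    supports, so no monomial outside the monoid ever appears. *)
Lemma monomial_algebra_supp S p :
  monomial_algebra S p -> forall m, m \in msupp p -> monomial_monoid S m.
Proof.
elim=> [c|m Sm|x y _ IHx _ IHy|x y _ IHx _ IHy] k.
- rewrite msuppC; case: ifP => // _; rewrite inE => /eqP ->; exact: monomial_monoid0.
- by rewrite msuppX inE => /eqP ->; apply: monomial_monoid_gen.
- by move/msuppD_le; rewrite mem_cat => /orP[/IHx|/IHy].
- move/msuppM_le => /allpairsP[[u v] /= [/IHx Su /IHy Sv ->]].
  exact: monomial_monoidD.
Qed.

Lemma monomial_algebraX S m :
  monomial_monoid S m -> monomial_algebra S 'X_[K, m].
Proof.
elim=> [|a b Sa _ IH]; first by rewrite mpolyX0; apply: (monomial_algebra_const S 1).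
by rewrite mpolyXD; apply: monomial_algebra_mul => //; apply: monomial_algebra_gen.
Qed.

Lemma monomial_algebra_sub S S' p :
  (forall m, S m -> S' m) -> monomial_algebra S p -> monomial_algebra S' p.
Proof.
move=> SS'; elim=> [c|m /SS' Sm|x y _ IHx _ IHy|x y _ IHx _ IHy].
- exact: monomial_algebra_const.
- exact: monomial_algebra_gen.
- exact: monomial_algebra_add.
- exact: monomial_algebra_mul.
Qed.

Lemma field_of_fractions_incl S p :
  monomial_algebra S p -> field_of_fractions (monomial_algebra S) (tofrac p).
Proof.
move=> Sp; exists p, 1; split; rewrite ?oner_eq0 ?tofrac1 ?divr1 //.
exact: (monomial_algebra_const S 1).
Qed.

Lemma field_of_fractionsD S (x y : {fraction {mpoly K[n]}}) :
  let Q := field_of_fractions (monomial_algebra S) in Q x -> Q y -> Q (x + y).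
Proof.
move=> Q [p [q [Sp Sq q0 ->]]] [p' [q' [Sp' Sq' q0' ->]]].
exists (p * q' + p' * q), (q * q'); split.
- by apply: monomial_algebra_add; apply: monomial_algebra_mul.
- exact: monomial_algebra_mul.
- by rewrite mulf_neq0.
- by rewrite addf_div ?tofrac_eq0 // !tofracD !tofracM.
Qed.

Lemma field_of_fractionsM S (x y : {fraction {mpoly K[n]}}) :
  let Q := field_of_fractions (monomial_algebra S) in Q x -> Q y -> Q (x * y).
Proof.
move=> Q [p [q [Sp Sq q0 ->]]] [p' [q' [Sp' Sq' q0' ->]]].
exists (p * p'), (q * q'); split; try exact: monomial_algebra_mul.
- by rewrite mulf_neq0.
- by rewrite mulf_div !tofracM.
Qed.

Lemma field_of_fractionsV S (x : {fraction {mpoly K[n]}}) :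
  let Q := field_of_fractions (monomial_algebra S) in Q x -> Q x^-1.
Proof.
move=> Q [p [q [Sp Sq q0 ->]]]; have [->|p0] := eqVneq p 0.
  rewrite tofrac0 mul0r invr0 -tofrac0; apply: field_of_fractions_incl.
  rewrite -mpolyC0; exact: monomial_algebra_const.
by exists q, p; split=> //; rewrite invf_div.
Qed.

Lemma cremonaP (F : {fset 'X_{1..n}}) :
  cremona K d F <->
  monomial_set d F /\
  forall m, mdeg m = d -> lattice_eq (fun f => f \in F) m 0%MM.
Proof.
split=> [[MF FE]|[MF FE]]; split=> //.
  move=> m md.
  have [p [q [Fp Fq q0]]] : field_of_fractions (monomial_algebra (fun f => f \in F))
      (tofrac 'X_[K, m]).
    by apply/FE/field_of_fractions_incl/monomial_algebra_gen.
  have q0F : tofrac q != 0 by rewrite tofrac_eq0.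
  move=> e; move: (congr1 (fun z => z * tofrac q) e).
  rewrite divfK // -tofracM => /eqP; rewrite tofrac_eq => /eqP {}e.
  (* From ['X_[K, m] * q = p], adding [m] to any monomial of [q] gives a monomial of [p]; the
     leading one serves as the choice. *)
  exists (mlead q), (m + mlead q)%MM.
  split; last by rewrite add0m.
    by apply: (monomial_algebra_supp Fq); apply: mlead_supp.
  apply: (monomial_algebra_supp Fp); rewrite -e mulrC mcoeff_msupp mcoeffMX.
  by rewrite -mcoeff_msupp; apply: mlead_supp.
(* Conversely, [lattice_eq] writes each monomial of degree [d] as a quotient of two monomials of the
   algebra of [F]; sums and products then stay in its field of fractions. *)
have FV p : monomial_algebra (fun f => mdeg f = d) p ->
    field_of_fractions (monomial_algebra (fun f => f \in F)) (tofrac p).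
  elim=> [c|m /FE[s [t [Ss St e]]]|x y _ IHx _ IHy|x y _ IHx _ IHy].
  - exact/field_of_fractions_incl/monomial_algebra_const.
  - exists 'X_[K, t], 'X_[K, s]; split; try exact: monomial_algebraX.
      by rewrite -msupp_eq0 msuppX.
    move: e; rewrite add0m => <-; rewrite mpolyXD tofracM mulfK //.
    by rewrite tofrac_eq0 -msupp_eq0 msuppX.
  - by rewrite tofracD; apply: field_of_fractionsD.
  - by rewrite tofracM; apply: field_of_fractionsM.
move=> z; split=> [][p [q [Ap Aq q0 ->]]].
  by exists p, q; split=> //;
     [move: Ap | move: Aq]; apply: monomial_algebra_sub; case: MF.
apply: field_of_fractionsM; first exact: FV.
by apply: field_of_fractionsV; apply: FV.
Qed.

End Cremona.

(** * The action of the symmetric group *)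

Section Action.

Variable n : nat.
Implicit Types (s t : 'S_n) (m a b : 'X_{1..n}) (F G : {fset 'X_{1..n}}).

Lemma act_monomialE s m i : act_monomial s m i = m (s^-1%g i).
Proof. by rewrite mnmE. Qed.

Lemma act_monomial1 m : act_monomial 1 m = m.
Proof. by apply/mnmP=> i; rewrite act_monomialE invg1 perm1. Qed.

Lemma act_monomialM s t m :
  act_monomial (s * t) m = act_monomial t (act_monomial s m).
Proof. by apply/mnmP=> i; rewrite !act_monomialE invMg permM. Qed.

Lemma act_monomialK s : cancel (act_monomial s) (act_monomial s^-1).
Proof. by move=> m; rewrite -act_monomialM mulgV act_monomial1. Qed.

Lemma act_monomialVK s : cancel (act_monomial s^-1) (act_monomial s).
Proof. by move=> m; rewrite -act_monomialM mulVg act_monomial1. Qed.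

Lemma act_monomial_inj s : injective (act_monomial s).
Proof. exact: can_inj (act_monomialK s). Qed.

Lemma act_monomial0 s : act_monomial s 0%MM = 0%MM.
Proof. by apply/mnmP=> i; rewrite act_monomialE !mnm0E. Qed.

Lemma act_monomialD s a b :
  act_monomial s (a + b)%MM = (act_monomial s a + act_monomial s b)%MM.
Proof. by apply/mnmP=> i; rewrite !(act_monomialE, mnmDE). Qed.

Lemma mdeg_act s m : mdeg (act_monomial s m) = mdeg m.
Proof.
rewrite !mdegE [RHS](reindex_inj (@perm_inj _ s^-1)) /=.
by apply: eq_bigr => i _; rewrite act_monomialE.
Qed.

Lemma square_freeP m : square_free m <-> forall i, m i <= 1.
Proof.
split=> H i; have := H i.
  apply: contraNT => mi; apply/mnm_lepP=> j.
  by rewrite mulmnE mnm1E; case: eqP => [<-|]; lia.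
by move=> mi; apply/negP=> /mnm_lepP/(_ i); rewrite mulmnE mnm1E eqxx; lia.
Qed.

Lemma mem_act_set s F m : (act_monomial s m \in act_set s F) = (m \in F).
Proof. by rewrite mem_imfset //; apply: act_monomial_inj. Qed.

Lemma mem_act_setV s F m : (m \in act_set s F) = (act_monomial s^-1 m \in F).
Proof. by rewrite -{1}[m](act_monomialVK s) mem_act_set. Qed.

Lemma act_set1 F : act_set 1 F = F.
Proof. by apply/fsetP=> m; rewrite mem_act_setV invg1 act_monomial1. Qed.

Lemma act_setM s t F : act_set (s * t) F = act_set t (act_set s F).
Proof. by apply/fsetP=> m; rewrite !mem_act_setV invMg act_monomialM. Qed.

Lemma equivalent_refl F : equivalent F F.
Proof. by exists 1%g; rewrite act_set1. Qed.

Lemma equivalent_sym F G : equivalent F G -> equivalent G F.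
Proof. by case=> s ->; exists s^-1%g; rewrite -act_setM mulgV act_set1. Qed.

Lemma equivalent_trans G F H :
  equivalent F G -> equivalent G H -> equivalent F H.
Proof. by case=> s -> [t ->]; exists (s * t)%g; rewrite act_setM. Qed.

Lemma card_act_set s F : #|` act_set s F| = #|` F|.
Proof. by rewrite card_imfset //; apply: act_monomial_inj. Qed.

Lemma lattice_eq_act s F a b :
  lattice_eq (fun f => f \in F) a b ->
  lattice_eq (fun f => f \in act_set s F) (act_monomial s a) (act_monomial s b).
Proof.
have mm x : monomial_monoid (fun f => f \in F) x ->
    monomial_monoid (fun f => f \in act_set s F) (act_monomial s x).
  elim=> [|u v Fu _ IH]; first by rewrite act_monomial0; constructor.
  by rewrite act_monomialD; constructor; rewrite ?mem_act_set.
move=> [x [y [/mm Fx /mm Fy e]]].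
by exists (act_monomial s x), (act_monomial s y); split; rewrite // -!act_monomialD e.
Qed.

(** The count over [F] does not see the order of the columns, which the action of a permutation may
    change. *)
Lemma row_onesE F i : #|` F| = n ->
  row_ones (log_matrix F) i = count (fun m : 'X_{1..n} => m i == 1) (enum_fset F).
Proof.
move=> Fn; rewrite /row_ones -sum1_count (big_nth 0%MM) big_mkord -sum1_card.
by rewrite [size _]Fn; apply: eq_bigl => j; rewrite inE mxE.
Qed.

Lemma row_ones_act s F i : #|` F| = n ->
  row_ones (log_matrix (act_set s F)) (s i) = row_ones (log_matrix F) i.
Proof.
move=> Fn; rewrite !row_onesE ?card_act_set //.
rewrite (seq.permP (enum_imfset _ _)); last by move=> ? ? _ _; apply: act_monomial_inj.
rewrite count_map; apply: (@eq_count _ _ (fun m : 'X_{1..n} => m i == 1)) => m /=.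
by rewrite act_monomialE permK.
Qed.

Lemma cremona_act (K : fieldType) d s F : cremona K d F -> cremona K d (act_set s F).
Proof.
move=> /cremonaP[[Fn Fd] FL]; apply/cremonaP; split.
  split=> [|m]; first by rewrite card_act_set.
  by rewrite mem_act_setV => /Fd <-; rewrite mdeg_act.
move=> m md; rewrite -[m](act_monomialVK s) -(act_monomial0 s).
by apply/lattice_eq_act/FL; rewrite mdeg_act.
Qed.

Lemma square_free_set_act s F : square_free_set F -> square_free_set (act_set s F).
Proof.
move=> FS m; rewrite mem_act_setV => /FS/square_freeP H; apply/square_freeP=> i.
by have := H (s^-1%g i); rewrite act_monomialE invgK permKV.
Qed.

End Action.

Lemma type1_square_free_cremona_act (K : fieldType) s F :
  type1_square_free_cremona K F -> type1_square_free_cremona K (act_set s F).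
Proof.
case=> cF sF [no5 [i ri]]; have [Fn _] := cF.1; split.
- exact: cremona_act.
- exact: square_free_set_act.
split; last by exists (s i); rewrite row_ones_act.
case=> j; rewrite -[j](permKV s) row_ones_act // => rj; apply: no5.
by exists (s^-1%g j).
Qed.

(** * Computation on lists of exponents *)

Fixpoint words01 (n : nat) : seq (seq nat) :=
  if n is n'.+1 then map (cons 0) (words01 n') ++ map (cons 1) (words01 n')
  else [:: [::]].

Fixpoint sublists (T : Type) (s : seq T) : seq (seq T) :=
  if s is x :: s' then map (cons x) (sublists s') ++ sublists s' else [:: [::]].

Definition permute_exponents (q e : seq nat) : seq nat :=
  [seq nth 0 e j | j <- q].

Definition weight_exponents (w e : seq nat) : nat :=
  sumn [seq nth 0 w j * nth 0 e j | j <- iota 0 6].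

Definition row_count (M : seq (seq nat)) (i : nat) : nat :=
  count (fun e => nth 0 e i == 1) M.

Definition perms6 : seq (seq nat) := permutations (iota 0 6).

Definition x012 : seq nat := [:: 1; 1; 1; 0; 0; 0].

(* The edge {a, b} stands for the product of the variables other than x_0, x_a
   and x_b. *)
Definition rep_of_graph (g : seq (nat * nat)) : seq (seq nat) :=
  x012 :: [seq [seq (i \notin [:: 0; ab.1; ab.2] : nat) | i <- iota 0 6] | ab <- g].

(* In this order: pentagons; triangles with horns at two vertices; triangles with
   two pendant edges at one vertex; triangles with a path of length two. The
   distinguished pair of vertices is always {1, 2}. *)
Definition reps : seq (seq (seq nat)) :=
  map rep_of_graph
    [:: [:: (1, 2); (2, 3); (3, 4); (4, 5); (5, 1)];
        [:: (1, 3); (3, 2); (2, 4); (4, 5); (5, 1)];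
        [:: (1, 2); (2, 3); (3, 1); (1, 4); (2, 5)];
        [:: (1, 2); (2, 3); (3, 1); (1, 4); (3, 5)];
        [:: (1, 2); (2, 3); (3, 1); (1, 4); (1, 5)];
        [:: (1, 2); (2, 3); (3, 1); (3, 4); (3, 5)];
        [:: (1, 2); (2, 3); (3, 1); (1, 4); (4, 5)];
        [:: (1, 2); (2, 3); (3, 1); (3, 4); (4, 5)];
        [:: (1, 3); (3, 4); (4, 1); (1, 2); (2, 5)];
        [:: (1, 3); (3, 4); (4, 1); (3, 2); (2, 5)]].

(** The relabellings that fix x_0 and the pair {1, 2}, i.e. the isomorphisms of graphs with a
    distinguished pair. *)
Definition perms_fixing_x012 : seq (seq nat) :=
  [seq 0 :: q1 ++ q2 | q1 <- permutations [:: 1; 2], q2 <- permutations [:: 3; 4; 5]].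

(** The constant is 4 = 2 + 1 + 1, one vertex of weight 2 in each triple. *)
Definition constant_weight (M : seq (seq nat)) (w : seq nat) : bool :=
  all (fun e => weight_exponents w e == 4) M.

(* Weight 2 on a set A of vertices meeting every triple exactly once and 1 on the
   other vertices; the weight of x_0 is then forced by x_0 x_1 x_2. *)
Definition bipartition_weights : seq (seq nat) :=
  [seq 4 - (nth 0 a 0).+1 - (nth 0 a 1).+1 :: map succn a
  | a <- words01 5 & a != nseq 5 (head 0 a)].

(** For x_0 x_1 x_2 and five edge complements, vertex i has row sum 5 - deg i, plus 1 if i is 1 or
    2. So a row with five ones means that 1 or 2 is a leaf or that one of 3, 4, 5 is isolated. A
    bipartite component is either an isolated vertex, which is then the set A of weight 2, or the
    whole graph, with A its side of size 2, or comes with an isolated vertex. *)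
Definition classified (M : seq (seq nat)) : bool :=
  [|| has (fun i => row_count M i == 5) (iota 0 6),
      has (constant_weight M) bipartition_weights
    | has (fun q => has (fun R => all (fun e => permute_exponents q e \in R) M) reps)
        perms_fixing_x012].

Definition cubics_without_x0 : seq (seq nat) :=
  map (cons 0) [seq e <- words01 5 | sumn e == 3].

(** Exhaustion over the 252 choices of five edges among the ten on five vertices. *)
Lemma classification_check :
  all (fun L => classified (x012 :: L))
    [seq L <- sublists cubics_without_x0 | size L == 5].
Proof. by vm_compute. Qed.

(** The symmetric group is transitive on pairs of a triple and a point of it. *)
Lemma transport_check :
  all (fun i =>
      all (fun e =>
          has (fun q => (nth 0 q 0 == i) && (permute_exponents q e == x012)) perms6)
        [seq e <- words01 6 | (sumn e == 3) && (nth 0 e i == 1)])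
    (iota 0 6).
Proof. by vm_compute. Qed.

(** All 720 permutations are tried: an equivalence need not fix x_0, since in the sixth
    representative x_3 also occurs in only one monomial. *)
Lemma inequivalence_check :
  all (fun R : seq (seq nat) => all (fun R' : seq (seq nat) => (R == R') ||
     all (fun q => ~~ all (fun e => permute_exponents q e \in R') R) perms6) reps) reps.
Proof. by vm_compute. Qed.

(* If f x_j = g x_i with f, g in R, then x_j / x_i = g / f. *)
Definition var_step (R : seq (seq nat)) (i j : nat) : bool :=
  (i == j) || has (fun f => has (fun g => incr_nth f j == incr_nth g i) R) R.

(** Closure of x_1 under [var_step] among x_1, ..., x_5. A step joins the ends of two edges with a
    common vertex, so it follows walks of even length; these reach every vertex because the graph is
    connected with an odd cycle. *)
Definition var_reach (R : seq (seq nat)) : seq nat :=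
  iter 5 (fun V => [seq j <- iota 1 5 | has (fun i => var_step R i j) V]) [:: 1].

Lemma reps_check :
  all (fun R : seq (seq nat) => [&& uniq R, size R == 6,
     all (fun e : seq nat => [&& size e == 6, sumn e == 3 & all (leq^~ 1) e]) R,
     all (fun i => row_count R i != 5) (iota 0 6),
     row_count R 0 == 1 , x012 \in R
   & var_reach R == iota 1 5]) reps.
Proof. by vm_compute. Qed.

(** * From lists of exponents to sets of monomials *)

Lemma mem_words01 n e : size e = n -> all (leq^~ 1) e -> e \in words01 n.
Proof.
elim: n e => [|n IH] [|x e] //= [en] /andP[x1 e1].
rewrite mem_cat; case: x x1 => [|[|x]] // _; apply/orP; [left | right];
  by rewrite mem_map ?IH // => ? ? [].
Qed.

Lemma filter_sublists (T : eqType) (p : pred T) (s : seq T) :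
  filter p s \in sublists s.
Proof.
elim: s => [|x s IH] //=; rewrite mem_cat; case: (p x); last by rewrite IH orbT.
by rewrite mem_map ?IH // => ? ? [].
Qed.

Definition exponents (m : 'X_{1..6}) : seq nat := [seq m i | i <- enum 'I_6].

Definition monom (e : seq nat) : 'X_{1..6} := [multinom nth 0 e i | i < 6].

Lemma size_exponents m : size (exponents m) = 6.
Proof. by rewrite size_map size_enum_ord. Qed.

Lemma nth_exponents m (i : 'I_6) : nth 0 (exponents m) i = m i.
Proof. by rewrite (nth_map i) ?size_enum_ord // nth_ord_enum. Qed.

Lemma exponentsK : cancel exponents monom.
Proof. by move=> m; apply/mnmP=> i; rewrite mnmE nth_exponents. Qed.

Lemma monomK e : size e = 6 -> exponents (monom e) = e.
Proof.
move=> e6; apply: (@eq_from_nth _ 0); rewrite ?size_exponents // => i i6.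
by rewrite (nth_exponents _ (Ordinal i6)) mnmE.
Qed.

Lemma mdeg_sumn m : mdeg m = sumn (exponents m).
Proof. by rewrite mdegE sumnE big_map big_enum. Qed.

Lemma exponents_words m : square_free m -> exponents m \in words01 6.
Proof.
move=> /square_freeP m1; apply: mem_words01; first exact: size_exponents.
by apply/allP=> x /mapP[i _ ->].
Qed.

Lemma weight_exponentsE w m :
  weight_exponents w (exponents m) = \sum_(i < 6) nth 0 w i * m i.
Proof.
rewrite /weight_exponents sumnE big_map -[iota 0 6]/(index_iota 0 6) big_mkord.
by apply: eq_bigr => i _; rewrite nth_exponents.
Qed.

(* The inverse appears because [act_monomial s] reads exponents through [s^-1]. *)
Definition inv_images (s : 'S_6) : seq nat := [seq val (s^-1%g i) | i <- enum 'I_6].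

Lemma nth_inv_images (s : 'S_6) (i : 'I_6) : nth 0 (inv_images s) i = s^-1%g i.
Proof. by rewrite (nth_map i) ?size_enum_ord // nth_ord_enum. Qed.

Lemma exponents_act s m :
  exponents (act_monomial s m) = permute_exponents (inv_images s) (exponents m).
Proof.
rewrite /permute_exponents -map_comp; apply: eq_map => i /=.
by rewrite nth_exponents act_monomialE.
Qed.

Lemma inv_images_perms6 s : inv_images s \in perms6.
Proof.
rewrite mem_permutations; apply: uniq_perm; rewrite ?iota_uniq //.
  by rewrite map_inj_uniq ?enum_uniq // => i j /val_inj/perm_inj.
move=> x; rewrite mem_iota /=; apply/mapP/idP=> [[i _ ->]|x6]; first exact: ltn_ord.
by exists (s (Ordinal x6)); rewrite ?mem_enum // permK.
Qed.

Lemma perms6_inv_images q : q \in perms6 -> exists s, q = inv_images s.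
Proof.
rewrite mem_permutations => pq; have q6 := perm_size pq; rewrite size_iota in q6.
have lt6 (i : 'I_6) : nth 0 q i < 6.
  have : nth 0 q i \in q by rewrite mem_nth ?q6.
  by rewrite (perm_mem pq) mem_iota.
have injq : injective (fun i : 'I_6 => Ordinal (lt6 i)).
  move=> i j [] /eqP; rewrite nth_uniq ?q6 //; first by move/eqP/val_inj.
  by rewrite (perm_uniq pq) iota_uniq.
(* Inverted because [inv_images] lists the values of the inverse. *)
exists (perm injq)^-1%g; apply: (@eq_from_nth _ 0).
  by rewrite q6 size_map size_enum_ord.
rewrite q6 => i i6; rewrite (nth_inv_images _ (Ordinal i6)) invgK permE //.
Qed.

Definition enumerates (F : {fset 'X_{1..6}}) (M : seq (seq nat)) : Prop :=
  perm_eq (map exponents (enum_fset F)) M.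

Lemma mem_enumerates F M m : enumerates F M -> (m \in F) = (exponents m \in M).
Proof.
by move=> FM; rewrite -(perm_mem FM) mem_map //; apply: can_inj exponentsK.
Qed.

Lemma card_enumerates F M : enumerates F M -> #|` F| = size M.
Proof. by move=> /perm_size <-; rewrite size_map. Qed.

Lemma row_ones_enumerates F M (i : 'I_6) :
  enumerates F M -> size M = 6 -> row_ones (log_matrix F) i = row_count M i.
Proof.
move=> FM M6; rewrite row_onesE ?(card_enumerates FM) //.
rewrite /row_count -(seq.permP FM) count_map; apply: eq_count => m /=.
by rewrite nth_exponents.
Qed.

Definition monom_set (R : seq (seq nat)) : {fset 'X_{1..6}} :=
  [fset monom e | e in R].

Lemma mem_monom_set R e : e \in R -> monom e \in monom_set R.
Proof. by move=> eR; apply/imfsetP; exists e. Qed.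

Lemma monom_set_enumerates R :
  uniq R -> (forall e, e \in R -> size e = 6) -> enumerates (monom_set R) R.
Proof.
move=> uR R6; apply: uniq_perm => //.
  by rewrite map_inj_uniq ?fset_uniq //; apply: can_inj exponentsK.
move=> e; apply/mapP/idP=> [[m /imfsetP[e' /= e'R ->] ->]|eR].
  by rewrite monomK ?R6.
by exists (monom e); rewrite ?monomK ?R6 //; apply: mem_monom_set.
Qed.

(** On sums of k elements of [S], degree and weight are k d and k c. Applied to the d-th power of
    each variable, this forces [w i * d = c]. *)
Lemma const_weight_obstruction n d (S : 'X_{1..n} -> Prop) (w : 'I_n -> nat) c :
  0 < d -> (forall f, S f -> mdeg f = d /\ \sum_i w i * f i = c) ->
  (forall m, mdeg m = d -> lattice_eq S m 0%MM) -> forall i j, w i = w j.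
Proof.
move=> d0 Sw SL.
have mm x : monomial_monoid S x -> exists k, mdeg x = k * d /\ \sum_i w i * x i = k * c.
  elim=> [|a b /Sw[ad aw] _ [k [kd kw]]].
    by exists 0; rewrite mdeg0 big1 // => i _; rewrite mnm0E muln0.
  exists k.+1; rewrite mdegD ad kd !mulSn -kw -aw -big_split /=; split=> //.
  by apply: eq_bigr => i _; rewrite mnmDE mulnDr.
suff wc i : w i * d = c by move=> i j; have := wc i; have := wc j; nia.
have [|s [t [/mm[k [kd kw]] /mm[k' [k'd k'w]] e]]] := SL (U_(i) *+ d)%MM.
  by rewrite mdegMn mdeg1 mul1n.
rewrite add0m in e; move: k'd k'w; rewrite -e mdegD mdegMn mdeg1 kd mul1n => k'd.
have -> : \sum_j w j * (U_(i) *+ d + s)%MM j = (w i * d + k * c)%N.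
  rewrite -kw (eq_bigr (fun j => w j * (U_(i) *+ d)%MM j + w j * s j)%N); last first.
    by move=> j _; rewrite mnmDE mulnDr.
  rewrite big_split /=; congr addn; rewrite (bigD1 i) //= mulmnE mnm1E eqxx mul1n.
  rewrite big1 ?addn0 // => j ji; rewrite mulmnE mnm1E eq_sym (negPf ji) //.
  by rewrite mul0n muln0.
(* Comparison of degrees: d + k d = k' d with d positive. *)
have -> : k' = k.+1 by nia.
by rewrite mulSn => /addIn.
Qed.

(** * Congruence of variables modulo the lattice *)

Lemma lattice_eq_sum n (S : 'X_{1..n} -> Prop) (u m : 'X_{1..n}) :
  (forall i, 0 < m i -> lattice_eq S U_(i)%MM u) ->
  lattice_eq S m (u *+ mdeg m)%MM.
Proof.
move=> mu; rewrite {1}[m]multinomUE_id mdegE.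
have mulu i k : lattice_eq S U_(i)%MM u -> lattice_eq S (U_(i) *+ k)%MM (u *+ k)%MM.
  move=> ui; elim: k => [|k IH]; first by rewrite !mulm0n; apply: lattice_eq_refl.
  by rewrite !mulmS; apply: lattice_eqD.
elim/big_ind2: _ => [|k x l y xk yl|i _]; first by rewrite mulm0n; apply: lattice_eq_refl.
  have -> : (u *+ (k + l) = u *+ k + u *+ l)%MM.
    by apply/mnmP=> i; rewrite mnmDE !mulmnE mulnDr.
  exact: lattice_eqD.
have [->|mi] := posnP (m i); last exact/mulu/mu.
by rewrite !mulm0n; apply: lattice_eq_refl.
Qed.

Lemma monom_incr e i : monom (incr_nth e i) = (monom e + monom (incr_nth [::] i))%MM.
Proof.
by apply/mnmP=> j; rewrite mnmDE !mnmE !nth_incr_nth nth_nil addn0 addnC.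
Qed.

Lemma monom_unit (i : 'I_6) : monom (incr_nth [::] i) = U_(i)%MM.
Proof.
by apply/mnmP=> j; rewrite mnmE mnm1E nth_incr_nth nth_nil addn0.
Qed.

Lemma var_step_lattice_eq R i j : var_step R i j ->
  lattice_eq (fun f => f \in monom_set R)
    (monom (incr_nth [::] i)) (monom (incr_nth [::] j)).
Proof.
case/orP=> [/eqP ->|/hasP[f fR /hasP[g gR /eqP fg]]]; first exact: lattice_eq_refl.
apply: (@lattice_eq_cancel _ _ _ _ (monom g) (monom f)).
  by rewrite addmC -monom_incr -fg [X in lattice_eq _ _ X]addmC -monom_incr;
     apply: lattice_eq_refl.
by apply: (@lattice_eq_gen _ (fun h => h \in monom_set R)); apply: mem_monom_set.
Qed.

Lemma var_reach_lattice_eq R j : j \in var_reach R ->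
  lattice_eq (fun f => f \in monom_set R)
    (monom (incr_nth [::] 1)) (monom (incr_nth [::] j)).
Proof.
rewrite /var_reach; move: {1}5 => k; elim: k j => [|k IH] j.
  by rewrite inE => /eqP ->; apply: lattice_eq_refl.
rewrite iterS mem_filter => /andP[/hasP[i /IH Hi ij] _].
by apply: lattice_eq_trans Hi _; apply: var_step_lattice_eq.
Qed.

(** * The ten representatives are Cremona sets of type 1 *)

Lemma reps_enumerates R : R \in reps -> enumerates (monom_set R) R.
Proof.
move=> /(allP reps_check)/and4P[uR _ /allP R3 _].
by apply: monom_set_enumerates => // e /R3/and3P[/eqP].
Qed.

Lemma reps_type1_square_free_cremona (K : fieldType) R :
  R \in reps -> type1_square_free_cremona K (monom_set R).
Proof.
move=> Rr; have RE := reps_enumerates Rr.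
have /and4P[uR /eqP R6 /allP R3 /and4P[/allP no5 /eqP row0 xR /eqP reach]] :=
  allP reps_check _ Rr.
have Rcard : #|` monom_set R| = 6 by rewrite (card_enumerates RE).
have Rdeg m : m \in monom_set R -> mdeg m = 3.
  by rewrite (mem_enumerates _ RE) mdeg_sumn => /R3/and3P[_ /eqP].
split; last first.
- split; last by exists ord0; rewrite (row_ones_enumerates _ RE).
  case=> i; rewrite (row_ones_enumerates _ RE) // => ri.
  by have := no5 i; rewrite ri mem_iota ltn_ord => /(_ isT).
- move=> m; rewrite (mem_enumerates _ RE) => /R3/and3P[_ _ /allP m1].
  apply/square_freeP=> i; apply: m1; rewrite -nth_exponents.
  by rewrite mem_nth // size_exponents.
apply/cremonaP; split=> // m md.
set S := fun f => f \in monom_set R; set u := monom (incr_nth [::] 1).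
(* All variables are shown congruent to [u], that is x_1, modulo the lattice; x_0 needs a separate
   argument. *)
have Uu (i : 'I_6) : 0 < i -> lattice_eq S U_(i)%MM u.
  move=> i0; rewrite -monom_unit; apply/lattice_eq_sym/var_reach_lattice_eq.
  by rewrite reach mem_iota i0 ltn_ord.
have Sx : S (monom x012) by apply: mem_monom_set.
(* Only one of the six monomials contains x_0, so some [g] avoids it, and [g] is congruent to
   [3u]. *)
have [g gR g0] : exists2 g, g \in R & nth 0 g 0 = 0.
  have /hasP[g gR g1] : has (predC (fun e => nth 0 e 0 == 1)) R.
    by rewrite has_predC all_count [X in X != _]row0 R6.
  exists g => //; have /and3P[/eqP g6 _ /allP/(_ (nth 0 g 0))] := R3 _ gR.
  rewrite mem_nth ?g6 // => /(_ isT); move: g1 => /=. lia.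
have gu : lattice_eq S (monom g) (u *+ 3)%MM.
  rewrite -[X in (u *+ X)%MM](Rdeg (monom g)) ?mem_monom_set //.
  apply: lattice_eq_sum => i.
  by rewrite mnmE; case: i => [[|i] ?] /=; rewrite ?g0 // => _; apply: Uu.
(* Additively, x_0 + 2u is congruent to x_0 x_1 x_2, hence to [g] and to 3u; then 2u cancels. *)
have xu : lattice_eq S U_(ord0)%MM u.
  apply: (@lattice_eq_cancel _ _ _ _ (u *+ 2)%MM (u *+ 2)%MM);
    last exact: lattice_eq_refl.
  rewrite -mulmS; apply: lattice_eq_trans _ gu.
  apply: (@lattice_eq_trans _ _ (monom x012)); last first.
    by apply: lattice_eq_gen => //; apply: mem_monom_set.
  pose y := monom [:: 0; 1; 1]; have -> : monom x012 = (U_(ord0) + y)%MM.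
    by apply/mnmP=> i; rewrite mnmDE !mnmE; case: i => [[|[|[|[|[|[|]]]]]]].
  apply: lattice_eqD; first exact: lattice_eq_refl.
  rewrite -[X in (u *+ X)%MM](_ : mdeg y = 2); last first.
    by rewrite mdegE !big_ord_recl big_ord0 !mnmE.
  apply/lattice_eq_sym/lattice_eq_sum => i.
  by rewrite mnmE; case: i => [[|i] ?] //= _; apply: Uu.
(* Every cubic is now congruent to 3u, hence to [g], which lies in the lattice. *)
apply: (@lattice_eq_trans _ _ (u *+ 3)%MM).
  rewrite -[X in (u *+ X)%MM]md; apply: lattice_eq_sum => i _.
  have [->|i0] := eqVneq i ord0; first exact: xu.
  by apply: Uu; rewrite lt0n.
apply: lattice_eq_trans (lattice_eq_sym gu) _.
by apply: lattice_eq0_gen; apply: mem_monom_set.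
Qed.

(** * Equivalence with a representative and the classification *)

Lemma act_monom_set s F M R : enumerates F M -> R \in reps -> size M = 6 ->
  (act_set s F == monom_set R) =
  all (fun e => permute_exponents (inv_images s) e \in R) M.
Proof.
move=> FM Rr M6; have RE := reps_enumerates Rr.
have /and4P[_ /eqP R6 _ _] := allP reps_check _ Rr.
(* Both sets have six elements, so inclusion is equality. *)
rewrite eqEfcard card_act_set (card_enumerates FM) (card_enumerates RE) M6 R6 andbT.
apply/fsubsetP/allP=> [sub e|all_in m].
  rewrite -(perm_mem FM) => /mapP[m mF ->].
  by rewrite -exponents_act -(mem_enumerates _ RE) sub ?mem_act_set.
rewrite mem_act_setV => mF; rewrite (mem_enumerates _ RE).
rewrite -[m](act_monomialVK s) exponents_act; apply: all_in.
by rewrite -(mem_enumerates _ FM).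
Qed.

Lemma reps_inequivalent R R' : R \in reps -> R' \in reps ->
  equivalent (monom_set R) (monom_set R') -> R = R'.
Proof.
move=> Rr R'r [s /eqP]; have /and4P[_ /eqP R6 _ _] := allP reps_check _ Rr.
rewrite eq_sym (act_monom_set _ (reps_enumerates Rr)) // => RR'.
have /orP[/eqP //|] := allP (allP inequivalence_check _ Rr) _ R'r.
by move/allP/(_ _ (inv_images_perms6 s)); rewrite RR'.
Qed.

Lemma transport F i m : m \in F -> square_free m -> mdeg m = 3 -> m i = 1 ->
  exists s : 'S_6, s i = ord0 /\ monom x012 \in act_set s F.
Proof.
move=> mF m1 md mi; have i6 : val i \in iota 0 6 by rewrite mem_iota ltn_ord.
have /hasP[q] : has (fun q => (nth 0 q 0 == i) &&
    (permute_exponents q (exponents m) == x012)) perms6.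
  apply: (allP (allP transport_check _ i6)).
  by rewrite mem_filter exponents_words // nth_exponents mi -mdeg_sumn md !eqxx.
move=> /perms6_inv_images[s ->] /andP[/eqP].
rewrite (nth_inv_images _ ord0) => /val_inj si.
rewrite -exponents_act => /eqP sm; exists s; split; first by rewrite -si permKV.
by rewrite -sm exponentsK mem_act_set.
Qed.

Lemma normalized_equivalent_rep (K : fieldType) F :
  type1_square_free_cremona K F -> monom x012 \in F ->
  row_ones (log_matrix F) ord0 = 1 ->
  exists2 R, R \in reps & equivalent F (monom_set R).
Proof.
move=> [/cremonaP[[F6 Fd] FL] Fs [no5 _]] xF row0.
(* Filtering the fixed list puts the other five monomials in the order in which [sublists] produces
   them. *)
pose L := [seq e <- cubics_without_x0 | monom e \in F].
have /allP c6 : all (fun e => size e == 6) cubics_without_x0 by vm_compute.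
have FM : enumerates F (x012 :: L).
  apply: uniq_perm.
  - by rewrite map_inj_uniq ?fset_uniq //; apply: can_inj exponentsK.
  - rewrite /= filter_uniq ?andbT; last by vm_compute.
    by rewrite mem_filter andbC.
  move=> e; rewrite inE mem_filter; apply/mapP/idP=> [[m mF ->]|]; last first.
    case/orP=> [/eqP ->|/andP[eF /c6/eqP e6]]; last by exists (monom e); rewrite ?monomK.
    by exists (monom x012); rewrite ?monomK.
  (* Row 0 has a single 1, already taken by x_0 x_1 x_2; every other monomial avoids x_0. *)
  have [m0|m0] := eqVneq (m ord0) 1.
    suff -> : m = monom x012 by rewrite monomK ?eqxx.
    move: row0; rewrite row_onesE // -size_filter; set s := filter _ _.
    have : m \in s by rewrite mem_filter m0 eqxx.
    have : monom x012 \in s by rewrite mem_filter xF mnmE.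
    by case: s => [|y [|]] //; rewrite !inE => /eqP -> /eqP.
  apply/orP; right; rewrite exponentsK mF /=.
  have := exponents_words (Fs _ mF); rewrite -[words01 6]/(map _ _ ++ map _ _) mem_cat.
  case/orP=> /mapP[e' e'w em]; last first.
    by move: m0; rewrite -(nth_exponents m ord0) em.
  rewrite em map_f // mem_filter e'w andbT.
  by have := Fd _ mF; rewrite mdeg_sumn em => /eqP.
have M6 : size (x012 :: L) = 6 by rewrite -(card_enumerates FM).
have : classified (x012 :: L).
  apply: (allP classification_check); rewrite mem_filter filter_sublists andbT.
  by case: M6 => ->.
case/or3P.
- case/hasP=> i; rewrite mem_iota => i6 /eqP ri; case: no5.
  by exists (Ordinal i6); rewrite (row_ones_enumerates _ FM).
- case/hasP=> w wB /allP wM.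
  (* These weights are nonconstant by construction, while the lattice criterion forces constancy. *)
  have /negP[] : ~~ all (fun i => nth 0 w i == nth 0 w 0) (iota 0 6).
    by move: w wB {wM}; apply/allP; vm_compute.
  have wS f : f \in F -> mdeg f = 3 /\ \sum_(i < 6) nth 0 w i * f i = 4.
    move=> fF; split; first exact: Fd.
    by rewrite -weight_exponentsE; apply/eqP/wM; rewrite -(mem_enumerates _ FM).
  apply/allP=> i; rewrite mem_iota => i6; apply/eqP.
  exact: (const_weight_obstruction (isT : 0 < 3) wS FL (Ordinal i6) ord0).
case/hasP=> q qP /hasP[R Rr sub]; exists R => //.
have /allP perms : all (mem perms6) perms_fixing_x012 by vm_compute.
have /perms6_inv_images[s qs] := perms _ qP.
by exists s; apply/esym/eqP; rewrite (act_monom_set _ FM) // -qs.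
Qed.

Theorem proposition18 (K : fieldType) :
  exists P : {fset {fset {fset 'X_{1..6}}}},
    (forall C : {fset {fset 'X_{1..6}}},
        C \in P <-> equivalence_class (type1_square_free_cremona K) C) /\
    #|` P| = 10.
Proof.
pose orbit R : {fset {fset 'X_{1..6}}} := [fset act_set s (monom_set R) | s : 'S_6].
have orbitP R G : G \in orbit R <-> equivalent (monom_set R) G.
  split=> [/imfsetP[s _ ->]|[s ->]]; first by exists s.
  by apply/imfsetP; exists s.
exists [fset C in map orbit reps]; split=> [C|]; last first.
  rewrite card_fseq undup_id ?size_map // map_inj_in_uniq; first by vm_compute.
  move=> R R' Rr R'r RR'; apply: reps_inequivalent => //.
  by apply/orbitP; rewrite RR'; apply/orbitP/equivalent_refl.
rewrite in_fset; split=> [/mapP[R Rr ->]|[F XF CF]].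
  exists (monom_set R) => [|G]; first exact: reps_type1_square_free_cremona.
  split=> [/orbitP RG|[_ /orbitP //]]; split=> //; case: RG => s ->.
  exact/type1_square_free_cremona_act/reps_type1_square_free_cremona.
have [R Rr FR] : exists2 R, R \in reps & equivalent F (monom_set R).
  have [/cremonaP[[F6 Fd] _] Fs [_ [i ri]]] := XF.
  (* The monomial responsible for the single 1 in row [i] is moved to x_0 x_1 x_2, with [i] sent to
     0. *)
  have /hasP[m mF /eqP mi] : has (fun m : 'X_{1..6} => m i == 1) (enum_fset F).
    by rewrite has_count -row_onesE ?ri.
  have [s [si xsF]] := transport mF (Fs _ mF) (Fd _ mF) mi.
  have [|//||R Rr sFR] := @normalized_equivalent_rep K (act_set s F).
  - exact: type1_square_free_cremona_act.
  - by rewrite -si row_ones_act.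
  by exists R => //; apply: equivalent_trans sFR; exists s.
apply/mapP; exists R => //; apply/fsetP=> G; apply/idP/idP => [/CF[_ FG]|/orbitP RG].
  by apply/orbitP/(equivalent_trans _ FG)/equivalent_sym.
apply/CF; have FG := equivalent_trans FR RG; split=> //; case: FG => s ->.
exact: type1_square_free_cremona_act.
Qed.
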